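(* The algorithm LI described in the context determines an optimal deviation vector, if one exists, for the constrained minimum-cost inverse optimization problem $(S,\mathcal{F},F^*,c,\ell,u,\|\cdot\|_{\infty,w})$ under the weighted $\ell_\infty$-norm objective (and otherwise outputs ''Infeasible''), using $O(n\cdot\|w\|_{-1})$ calls to the oracle $\mathcal{O}$, where $n=|S|$ and $\|w\|_{-1}=\sum_{s\in S}\frac{1}{w(s)}$.
   Context: An instance consists of: a finite ground set $S$ with $n=|S|$; a collection $\mathcal{F}\subseteq 2^S$ of feasible solutions of an underlying optimization problem; an input solution $F^*\in\mathcal{F}$; a cost function $c\in\mathbb{R}^S$; a positive weight function $w\in\mathbb{R}_+^S$, scaled so that $1/w(s)$ is an integer for each $s\in S$; and bounds $\ell\colon S\to\mathbb{R}\cup\{-\infty\}$, $u\colon S\to\mathbb{R}\cup\{+\infty\}$ with $\ell\le u$. For $x\in\mathbb{R}^S$ and $X\subseteq S$, $x(X)=\sum_{s\in X}x(s)$, and $\frac1w(X)=\sum_{s\in X}\frac{1}{w(s)}$. $X\triangle Y$ denotes symmetric difference. Conventions: $\min\emptyset=+\infty$, $\max\emptyset=-\infty$. The oracle $\mathcal{O}$ returns, for any $c'\in\mathbb{R}^S$, a member of $\mathcal{F}$ of minimum $c'$-cost. A deviation vector $p\in\mathbb{R}^S$ is feasible if (a) $F^*$ is a minimum-cost member of $\mathcal{F}$ with respect to $c-p$, and (b) $\ell\le p\le u$. It is optimal if it is feasible and minimizes, among feasible deviation vectors, $\|p\|_{\infty,w}=\max\{w(s)\cdot|p(s)|\mid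 s\in S\}$. For $\delta\ge 0$ define $p_\delta\colon S\to\mathbb{R}$ as follows. For $s\in F^*$: - $p_\delta(s)=\ell(s)$ if $\delta/w(s)<\ell(s)$; - $p_\delta(s)=\delta/w(s)$ if $\ell(s)\le\delta/w(s)\le u(s)$; - $p_\delta(s)=u(s)$ if $u(s)<\delta/w(s)$. For $s\in S\setminus F^*$: - $p_\delta(s)=\ell(s)$ if $-\delta/w(s)<\ell(s)$; - $p_\delta(s)=-\delta/w(s)$ if $\ell(s)\le-\delta/w(s)\le u(s)$; - $p_\delta(s)=u(s)$ if $u(s)<-\delta/w(s)$. Algorithm LI: 1. Set $d_0=\max\{0,\ \max\{w(s)\cdot\ell(s)\mid s\in S,\ \ell(s)>0\},\ \max\{w(s)\cdot|u(s)|\mid s\in S,\ u(s)<0\}\}$ and $c_0=c-p_{d_0}$. Let $F_0$ be a minimum $c_0$-cost member of $\mathcal{F}$ determined by $\mathcal{O}$. Set $i=0$. 2. While $c_i(F^* )>c_i(F_i)$, do the following. Let $$S_i=\{s\in F^*\mid d_i<w(s)\cdot u(s)\}\cup\{s\in S\setminus F^*\mid d_i>w(s)\cdot\ell(s)\}.$$ If $(F^*\triangle F_i)\cap S_i=\emptyset$, return ''Infeasible'' and stop. Otherwise set $$\delta_{i+1}=\min\Big\{\frac{c_i(F^* )-c_i(F_i)}{\frac1w\big((F^*\triangle F_i)\cap S_i\big)},\ \min_{s\in F^*\cap S_i}\Big\{u(s)-\frac{d_i}{w(s)}\Big\},\ \min_{s\in S_i\setminus F^*}\Big\{\frac{d_i}{w(s)}-\ell(s)\Big\}\Big\},$$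 $d_{i+1}=d_i+\delta_{i+1}$ and $c_{i+1}=c-p_{d_{i+1}}$, let $F_{i+1}$ be a minimum $c_{i+1}$-cost member of $\mathcal{F}$ determined by $\mathcal{O}$, and increase $i$ by $1$. 3. Return $p_{d_i}$.
   Formalization: In the definition of S_i, the condition for s in S∖F* is corrected from d_i > w(s)·ℓ(s) to -d_i > w(s)·ℓ(s), since with the printed sign the algorithm may loop forever; the oracle-call bound is stated for n ≥ 1. *)

(* Defs.v *)
(* MathComp world; the reals are an arbitrary [R : realType], and the bounds
   live in the extended reals [\bar R]. *)
From HB Require Import structures.
From mathcomp Require Import all_boot all_order all_algebra.
From mathcomp Require Import constructive_ereal reals.

Set Implicit Arguments.
Unset Strict Implicit.
Unset Printing Implicit Defensive.

Import Order.TTheory GRing.Theory Num.Theory.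

Local Open Scope ring_scope.

Record instance (R : realType) (S : finType) := Instance {
  feas : {set {set S}};
  Fstar : {set S};
  cost : {ffun S -> R};
  weight : {ffun S -> R};
  lo : S -> \bar R;
  hi : S -> \bar R;
  Fstar_feas : Fstar \in feas;
  weight_gt0 : forall s, 0 < weight s;
  weight_inv_int : forall s, (weight s)^-1 \is a Num.int;
  lo_neq_pinfty : forall s, lo s != +oo%E;
  hi_neq_ninfty : forall s, hi s != -oo%E;
  lo_le_hi : forall s, (lo s <= hi s)%E
}.

Definition sum_on (R : realType) (S : finType) (x : {ffun S -> R})
    (X : {set S}) : R :=
  \sum_(s in X) x s.

Definition symdiff (S : finType) (X Y : {set S}) : {set S} :=
  (X :\: Y) :|: (Y :\: X).

Section InverseProblem.
Variables (R : realType) (S : finType) (I : instance R S).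

Definition min_cost_member (c' : {ffun S -> R}) (F : {set S}) : Prop :=
  F \in feas I /\ forall G, G \in feas I -> sum_on c' F <= sum_on c' G.

Definition is_oracle (O : {ffun S -> R} -> {set S}) : Prop :=
  forall c', min_cost_member c' (O c').

Definition feasible_deviation (p : {ffun S -> R}) : Prop :=
  min_cost_member (cost I - p) (Fstar I) /\
  forall s, (lo I s <= (p s)%:E <= hi I s)%E.

(* All terms are nonnegative, so starting the maximum at 0 only matters for
   an empty ground set. *)
Definition wnorm_infty (p : {ffun S -> R}) : R :=
  \big[Num.max/0]_s (weight I s * `|p s|).

Definition optimal_deviation (p : {ffun S -> R}) : Prop :=
  feasible_deviation p /\
  forall q, feasible_deviation q -> wnorm_infty p <= wnorm_infty q.

Definition inv_weight (X : {set S}) : R := \sum_(s in X) (weight I s)^-1.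

(* [fine] is only applied to finite values: a bound strictly above (resp.
   below) a real is not -oo (resp. +oo), and the instance excludes the other
   infinity. *)
Definition clamp (s : S) (x : R) : R :=
  if (x%:E < lo I s)%E then fine (lo I s)
  else if (hi I s < x%:E)%E then fine (hi I s)
  else x.

Definition dev (d : R) : {ffun S -> R} :=
  [ffun s => if s \in Fstar I then clamp s (d / weight I s)
             else clamp s (- (d / weight I s))].

Definition cost_at (d : R) : {ffun S -> R} := cost I - dev d.

Local Open Scope ereal_scope.

Definition LI_start : R :=
  fine (maxe 0
    (maxe (\big[maxe/-oo]_(s | 0 < lo I s) ((weight I s)%:E * lo I s))
          (\big[maxe/-oo]_(s | hi I s < 0) ((weight I s)%:E * `|hi I s|)))).

(* The elements whose deviation still moves when [d] increases. Outside
   [Fstar I] the deviation is [- (d / weight I s)], so it is still above its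
   lower bound when [- d], rather than [d], exceeds [weight I s * lo I s]. *)
Definition LI_active (d : R) : {set S} :=
  [set s in Fstar I | d%:E < (weight I s)%:E * hi I s] :|:
  [set s in ~: Fstar I | (weight I s)%:E * lo I s < (- d)%:E].

(* Since [(weight I s)^-1 >= 1], each of the last two minima is at least the
   distance from [d] to the corresponding breakpoint of [dev]; a step may go
   past a breakpoint. *)
Definition LI_increment (d : R) (F : {set S}) : R :=
  fine (mine
    ((sum_on (cost_at d) (Fstar I) - sum_on (cost_at d) F)
       / inv_weight (symdiff (Fstar I) F :&: LI_active d))%R%:E
    (mine
      (\big[mine/+oo]_(s in Fstar I :&: LI_active d)
         (hi I s - (d / weight I s)%:E))
      (\big[mine/+oo]_(s in LI_active d :\: Fstar I)
         ((d / weight I s)%:E - lo I s)))).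

Local Close Scope ereal_scope.

Inductive outcome := Solution of {ffun S -> R} | Infeasible.

(* [Running d F k]: the test of the while loop is about to be evaluated with
   current value [d] and oracle answer [F]. In both constructors [k] is the
   number of oracle calls made so far. *)
Inductive LI_state :=
  | Running of R & {set S} & nat
  | Halted of outcome & nat.

Variable O : {ffun S -> R} -> {set S}.

Definition LI_init : LI_state :=
  Running LI_start (O (cost_at LI_start)) 1.

Definition LI_step (st : LI_state) : LI_state :=
  match st with
  | Running d F k =>
      if sum_on (cost_at d) F < sum_on (cost_at d) (Fstar I) then
        if symdiff (Fstar I) F :&: LI_active d == set0 then
          Halted Infeasible k
        else
          let d' := d + LI_increment d F in
          Running d' (O (cost_at d')) k.+1
      else Halted (Solution (dev d)) k
  | Halted _ _ => st
  end.

Definition LI_returns (out : outcome) (calls : nat) : Prop :=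
  exists m : nat, iter m LI_step LI_init = Halted out calls.

End InverseProblem.

Arguments Solution {R S}.
Arguments Infeasible {R S}.

(* Main.v *)
Require Import Defs.
From HB Require Import structures.
From mathcomp Require Import all_boot all_order all_algebra.
From mathcomp Require Import constructive_ereal reals.
From mathcomp Require Import ring lra zify.

Set Implicit Arguments.
Unset Strict Implicit.
Unset Printing Implicit Defensive.

Import Order.TTheory GRing.Theory Num.Theory.

Local Open Scope ring_scope.

(** The deviation of an element is counted positively when it favours the
    input solution [Fstar I]: as it is inside [Fstar I], negated outside
    ([push]). From the starting value on, [dev I d] then sends every element
    [s] to the smaller of [d / w s] and a constant, possibly infinite. So the
    gap of a member [F], the amount by which [F] is cheaper than [Fstar I] after
    the costs are modified, is a convex, piecewise affine, nonincreasing
    function of [d]. Just after [d] it descends at a rate, here called its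
    [slope], equal to the inverse weight of the active elements in the symmetric
    difference of [Fstar I] and [F].

    Optimality. A feasible deviation of norm [e] remains feasible when replaced
    by [dev I e], which favours [Fstar I] at least as much element by element
    ([feasible_dev_wnorm]); moreover [e] is at least the starting value, and
    [dev I d] has norm at most [d]. Hence the optimum is [dev I d] for the
    least [d] at which no member has a positive gap. An increment is at most
    the Newton step for the gap of the current member, and a convex function
    stays above its tangents ([gap_tangent]), so the search never overshoots
    this least [d]. If a member of positive gap has slope 0, its gap
    stays positive forever and the problem is infeasible.

    Number of calls. Let [W] be the sum of the inverse weights. If an iteration
    deactivates no element, it is a full Newton step along an affine piece, and
    the slope of the next member is strictly smaller; slopes are natural numbers
    at most [W]. Active elements are never reactivated, so at most
    [#|S|] iterations deactivate something. This is the lexicographic argument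
    of [potential_decreases]; it bounds the number of calls by
    [1 + #|S| * (W + 1) + W], which is at most [4 * #|S| * W] because every
    inverse weight is at least 1. *)

(** * Truncating a real number to an extended interval *)

Section Clip.
Variable R : realType.
Implicit Types (a b : \bar R) (x y : R).

(** The common shape of [clamp] on both sides of the input solution. *)
Definition clip a b x : R :=
  if (x%:E < a)%E then fine a else if (b < x%:E)%E then fine b else x.

Lemma clip_itv a b x : a != +oo%E -> b != -oo%E -> (a <= b)%E ->
  (a <= (clip a b x)%:E <= b)%E.
Proof.
rewrite /clip; case: a b => [a| |] [b| |] //= _ _;
  rewrite ?lee_fin ?lte_fin ?leey ?leNye ?ltNyr ?ltry => ab;
  do ?case: ifP => //; rewrite ?lee_fin ?leey ?leNye //=; lra.
Qed.

Lemma clipN a b x : a != +oo%E -> b != -oo%E -> (a <= b)%E ->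
  - clip a b (- x) = clip (- b)%E (- a)%E x.
Proof.
rewrite /clip; case: a b => [a| |] [b| |] //= _ _;
  rewrite ?lee_fin ?lte_fin ?leey ?leNye ?ltNyr ?ltry => ab;
  do ?case: ifP => //=; lra.
Qed.

(** Past the upper end [b] the truncation is constant, and elsewhere above [a]
    its increments are at most those of [x]. *)
Lemma clip_lip a b x y : b != -oo%E -> (a <= x%:E)%E -> x <= y ->
  clip a b y - clip a b x <= if (x%:E < b)%E then y - x else 0.
Proof.
rewrite /clip; case: a b => [a| |] [b| |] //= _;
  rewrite ?lee_fin ?lte_fin ?leey ?leNye ?ltNyr ?ltry //=;
  do ?case: ifP => //=; lra.
Qed.

Lemma clip_below a b x : (a <= x%:E)%E -> (x%:E < b)%E -> clip a b x = x.
Proof. by rewrite /clip => ax xb; rewrite ltNge ax /= ltNge (ltW xb). Qed.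

Lemma clip_above a b x : (a <= x%:E)%E -> (b <= x%:E)%E -> clip a b x = fine b.
Proof.
rewrite /clip => ax; rewrite ltNge ax /= le_eqVlt.
by case/orP => [/eqP ->|->] //=; rewrite ltxx.
Qed.

(** The truncation of [x] is [x] itself or [b], which is at least [- x]. *)
Lemma clip_norm a b x : 0 <= x -> (a <= x%:E)%E -> ((- x)%:E <= b)%E ->
  `|clip a b x| <= x.
Proof.
rewrite /clip => x0 ax; rewrite ltNge ax /=.
case: b => [b| |] //=; rewrite ?lee_fin ?lte_fin ?ltNyr ?leeNy_eq //.
- by move=> xb; case: ifP => bx; rewrite ler_norml; lra.
- by rewrite ger0_norm.
Qed.

(** Any point [z] of the interval below [x] shows that truncation only lowers
    [x], to the smaller of [x] and [b], which [z] does not exceed. *)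
Lemma le_clip a b x z : (a <= z%:E)%E -> (z%:E <= b)%E -> z <= x ->
  z <= clip a b x.
Proof.
rewrite /clip; case: a b => [a| |] [b| |] //=;
  rewrite ?lee_fin ?lte_fin ?leey ?leNye ?ltNyr ?ltry //=;
  do ?case: ifP => //=; lra.
Qed.

End Clip.

Section Inverse.
Variables (R : realType) (S : finType) (I : instance R S).
Implicit Types (s : S) (F : {set S}) (d e : R) (p q : {ffun S -> R}).

Local Notation w := (weight I).

(** * Orienting deviations towards the input solution *)

(** Counting a deviation negatively outside the input solution makes positive
    values always favour it, so both cases of [dev] become one. *)
Definition push p s : R := if s \in Fstar I then p s else - p s.
Definition floor s : \bar R :=
  if s \in Fstar I then lo I s else (- hi I s)%E.
Definition cap s : \bar R :=
  if s \in Fstar I then hi I s else (- lo I s)%E.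

Lemma cap_neq_ninfty s : cap s != -oo%E.
Proof.
rewrite /cap; case: ifP => _; first exact: hi_neq_ninfty.
by have := lo_neq_pinfty I s; case: (lo I s).
Qed.

Lemma push_dev d s : push (dev I d) s = clip (floor s) (cap s) (d / w s).
Proof.
rewrite /push /dev ffunE /floor /cap; case: (s \in Fstar I) => //.
by apply: clipN; rewrite ?lo_neq_pinfty ?hi_neq_ninfty ?lo_le_hi.
Qed.

Lemma push_itv p s : (lo I s <= (p s)%:E <= hi I s)%E ->
  (floor s <= (push p s)%:E <= cap s)%E.
Proof.
rewrite /floor /cap /push; case: (s \in Fstar I) => // /andP[? ?].
by rewrite !EFinN !leeN2; apply/andP.
Qed.

Lemma dev_itv d s : (lo I s <= (dev I d s)%:E <= hi I s)%E.
Proof.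
by rewrite /dev ffunE; case: ifP => _; apply: clip_itv;
  rewrite ?lo_neq_pinfty ?hi_neq_ninfty ?lo_le_hi.
Qed.

Lemma activeE d s : (s \in LI_active I d) = ((d / w s)%:E < cap s)%E.
Proof.
have w0 := weight_gt0 I s.
rewrite /LI_active !inE /cap; case: ifP => _ /=; rewrite ?orbF mulrC EFinM.
  by rewrite lte_pdivrMl.
by rewrite lteNr -EFinN -mulrN EFinM lte_pdivlMl.
Qed.

Lemma active_nonincreasing d e : d <= e -> LI_active I e \subset LI_active I d.
Proof.
move=> de; apply/subsetP => s; rewrite !activeE; apply: le_lt_trans.
by rewrite lee_fin ler_pM2r // invr_gt0 weight_gt0.
Qed.

(** * The starting value *)

Lemma LI_start_fin : ((LI_start I)%:E =
  maxe 0 (maxe (\big[maxe/-oo]_(s | 0 < lo I s) ((w s)%:E * lo I s))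
          (\big[maxe/-oo]_(s | hi I s < 0) ((w s)%:E * `|hi I s|))))%E.
Proof.
rewrite /LI_start fineK // fin_numElt; apply/andP; split.
  by rewrite lt_max ltNyr.
rewrite !gt_max ltry /=; apply/andP; split; apply/bigmax_ltP; split => // s.
  by have := lo_neq_pinfty I s; case: (lo I s) => [x| |] //= _; rewrite -EFinM ltry.
by have := hi_neq_ninfty I s; case: (hi I s) => [x| |] //= _; rewrite ltry.
Qed.

(** The starting value is the least one whose box [[- d / w, d / w]] meets every
    interval of admissible deviations. *)
Lemma LI_start_leP e :
  reflect (0 <= e /\ forall s, (lo I s <= (e / w s)%:E)%E /\
                               ((- (e / w s))%:E <= hi I s)%E)
          (LI_start I <= e).
Proof.
rewrite -(lee_fin (LI_start I)) LI_start_fin !ge_max lee_fin.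
have loP s : ((lo I s <= (e / w s)%:E) = ((w s)%:E * lo I s <= e%:E))%E.
  by rewrite mulrC EFinM lee_pdivlMl ?weight_gt0.
have hiP s : (hi I s < 0 ->
    ((- (e / w s))%:E <= hi I s) = ((w s)%:E * `|hi I s| <= e%:E))%E.
  move=> h0; rewrite lte0_abs // EFinN leeNl mulrC EFinM.
  by rewrite lee_pdivlMl ?weight_gt0.
apply: (iffP and3P) => -[e0].
  move=> /bigmax_leP[_ elo] /bigmax_leP[_ ehi]; split=> // s.
  have ew : 0 <= e / w s by rewrite divr_ge0 // ltW // weight_gt0.
  split.
    have [s0|s0] := ltP 0%E (lo I s); first by rewrite loP elo.
    by apply: le_trans s0 _; rewrite lee_fin.
  have [s0|s0] := ltP (hi I s) 0%E; first by rewrite hiP // ehi.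
  by apply: le_trans s0; rewrite lee_fin oppr_le0.
move=> eP; split=> //; apply/bigmax_leP; split; rewrite ?leNye // => s hs.
  by rewrite -loP; case: (eP s).
by rewrite -hiP //; case: (eP s).
Qed.

Lemma ratio_bounds d s : LI_start I <= d ->
  [/\ 0 <= d / w s, (floor s <= (d / w s)%:E)%E & ((- (d / w s))%:E <= cap s)%E].
Proof.
move=> /LI_start_leP[d0 /(_ s)[hlo hhi]].
have dw : 0 <= d / w s by rewrite divr_ge0 // ltW // weight_gt0.
rewrite /floor /cap; case: (s \in Fstar I); split=> //.
  by rewrite leeNl -EFinN.
by rewrite EFinN leeN2.
Qed.

(** * The behaviour of the deviation along the search *)

Lemma push_dev_lip d e s : LI_start I <= d -> d <= e ->
  push (dev I e) s - push (dev I d) s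
    <= if s \in LI_active I d then (e - d) / w s else 0.
Proof.
move=> hd de; have [_ h1 _] := ratio_bounds s hd.
rewrite !push_dev activeE mulrBl clip_lip ?cap_neq_ninfty //.
by rewrite ler_pM2r // invr_gt0 weight_gt0.
Qed.

(** An element active at [e] has stayed below its cap on the whole way from
    [d]; one inactive at [d] has been at its cap. *)
Lemma push_dev_linear d e s : LI_start I <= d -> d <= e ->
  LI_active I e = LI_active I d ->
  push (dev I e) s - push (dev I d) s
    = if s \in LI_active I d then (e - d) / w s else 0.
Proof.
move=> hd de eA; have [_ h1 _] := ratio_bounds s hd.
have [_ h2 _] := ratio_bounds s (le_trans hd de).
rewrite !push_dev; have := activeE e s; rewrite eA activeE.
case: ltP => hs /esym hs'.
  by rewrite !clip_below // mulrBl.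
by rewrite !clip_above ?subrr // leNgt hs'.
Qed.

Lemma wnorm_dev d : LI_start I <= d -> wnorm_infty I (dev I d) <= d.
Proof.
move=> hd; have /LI_start_leP[d0 _] := hd.
apply/bigmax_leP; split=> // s _; have w0 := weight_gt0 I s.
have [h0 h1 h2] := ratio_bounds s hd.
have -> : `|dev I d s| = `|push (dev I d) s|.
  by rewrite /push; case: ifP; rewrite ?normrN.
by rewrite mulrC -ler_pdivlMr // push_dev clip_norm.
Qed.

Lemma ler_wnorm q s : `|q s| <= wnorm_infty I q / w s.
Proof.
rewrite ler_pdivlMr ?weight_gt0 // mulrC.
exact: (le_bigmax _ (fun s => w s * `|q s|)).
Qed.

Lemma LI_start_le_wnorm q : (forall s, lo I s <= (q s)%:E <= hi I s)%E ->
  LI_start I <= wnorm_infty I q.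
Proof.
move=> qI; apply/LI_start_leP; split=> [|s].
  rewrite /wnorm_infty; elim/big_ind: _ => // [x y x0 _|t _].
    by rewrite le_max x0.
  by rewrite mulr_ge0 // ltW // weight_gt0.
have /andP[q1 q2] := qI s; have := ler_wnorm q s; rewrite ler_norml.
case/andP=> q3 q4; split; first by apply: le_trans q1 _; rewrite lee_fin.
by apply: le_trans q2; rewrite lee_fin.
Qed.

(** The push of [q] at [s] obeys the cap and the bound [wnorm_infty I q / w s];
    the deviation on the right attains the tighter of the two. *)
Lemma push_le_dev q s : (lo I s <= (q s)%:E <= hi I s)%E ->
  push q s <= push (dev I (wnorm_infty I q)) s.
Proof.
move=> /push_itv/andP[q1 q2]; rewrite push_dev; apply: le_clip => //.
have := ler_wnorm q s; rewrite ler_norml => /andP[q3 q4].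
by rewrite /push; case: ifP => _; lra.
Qed.

(** * How much cheaper a member is than the input solution *)

Definition gap p F : R :=
  sum_on (cost I - p) (Fstar I) - sum_on (cost I - p) F.

Lemma feasible_deviationP p :
  feasible_deviation I p <->
  (forall F, F \in feas I -> gap p F <= 0) /\
  (forall s, lo I s <= (p s)%:E <= hi I s)%E.
Proof.
split=> -[pmin pI]; split=> //.
  by move=> F FI; rewrite subr_le0; apply: pmin.2.
by split=> [|F FI]; [exact: Fstar_feas|rewrite -subr_le0; apply: pmin].
Qed.

Lemma gapE p F : gap p F = sum_on (cost I) (Fstar I) - sum_on (cost I) F
  - \sum_(s in symdiff (Fstar I) F) push p s.
Proof.
rewrite /gap /sum_on /push !(big_mkcond (fun s => s \in _)) -!sumrB.
apply: eq_bigr => s _; rewrite !inE !ffunE.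
by case: (s \in Fstar I); case: (s \in F) => /=; ring.
Qed.

Lemma gapB p q F :
  gap p F - gap q F = \sum_(s in symdiff (Fstar I) F) (push q s - push p s).
Proof. by rewrite !gapE sumrB; ring. Qed.

(** Minus the right derivative of the gap of [F] at [d], from [LI_start I]
    on. *)
Definition slope d F : R :=
  inv_weight I (symdiff (Fstar I) F :&: LI_active I d).

Lemma slopeE d e F : (e - d) * slope d F =
  \sum_(s in symdiff (Fstar I) F)
    (if s \in LI_active I d then (e - d) / w s else 0).
Proof.
rewrite /slope /inv_weight mulr_sumr -big_mkcondr.
by apply: eq_bigl => s; rewrite inE.
Qed.

(** The gap is a convex function of [d], so it stays above its tangents; hence
    a Newton step never passes a zero of the gap. *)
Lemma gap_tangent d e F : LI_start I <= d -> d <= e ->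
  gap (dev I d) F - gap (dev I e) F <= (e - d) * slope d F.
Proof.
move=> hd de; rewrite gapB slopeE; apply: ler_sum => s _.
exact: push_dev_lip.
Qed.

Lemma gap_linear d e F : LI_start I <= d -> d <= e ->
  LI_active I e = LI_active I d ->
  gap (dev I d) F - gap (dev I e) F = (e - d) * slope d F.
Proof.
move=> hd de eA; rewrite gapB slopeE; apply: eq_bigr => s _.
exact: push_dev_linear.
Qed.

(** This reduces the search for an optimal deviation to the curve [dev I]: no
    push decreases, so no gap increases. *)
Lemma feasible_dev_wnorm q : feasible_deviation I q ->
  feasible_deviation I (dev I (wnorm_infty I q)).
Proof.
move=> /feasible_deviationP[qmin qI]; apply/feasible_deviationP; split.
  move=> F FI; apply: le_trans (qmin F FI); rewrite -subr_ge0 gapB.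
  by apply: sumr_ge0 => s _; rewrite subr_ge0 push_le_dev.
exact: dev_itv.
Qed.

(** * The increment *)

Lemma slope_gt0 d F : symdiff (Fstar I) F :&: LI_active I d != set0 ->
  0 < slope d F.
Proof.
case/set0Pn => s hs; rewrite /slope /inv_weight (bigD1 s) //=.
rewrite ltr_pwDl ?invr_gt0 ?weight_gt0 // sumr_ge0 // => t _.
by rewrite invr_ge0 ltW // weight_gt0.
Qed.

Lemma weight_inv_ge1 s : 1 <= (w s)^-1.
Proof.
have w0 : 0 < (w s)^-1 by rewrite invr_gt0 weight_gt0.
have /intrP[m mE] := weight_inv_int I s.
by move: w0; rewrite mE ltr0z ler1z.
Qed.

(** The property shared by the last two minima in the increment; an empty
    minimum is infinite. *)
Definition deactivating d (x : \bar R) : Prop :=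
  x = +oo%E \/ exists r : R, [/\ x = r%:E, 0 < r &
    exists2 s, s \in LI_active I d & s \notin LI_active I (d + r)].

(** Because [1 / w >= 1], moving by at least the distance from [d / w] to the
    cap moves [d / w] to the cap or beyond. *)
Lemma deactivating_cap d (x : \bar R) s : s \in LI_active I d ->
  (cap s - (d / w s)%:E <= x)%E -> deactivating d x.
Proof.
move=> sA; have := sA; rewrite activeE; have w1 := weight_inv_ge1 s.
case capE : (cap s) => [b| |]; case: x => [r| |] //=; try by left.
rewrite lte_fin -EFinB lee_fin => db br; right; exists r; split=> //.
  by lra.
exists s => //; rewrite activeE capE lte_fin -leNgt mulrDl.
have : r <= r / w s by rewrite ler_peMr //; lra.
lra.
Qed.

Lemma LI_incrementP d F (delta := LI_increment I d F)
    (newton := gap (dev I d) F / slope d F) :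
  LI_start I <= d -> 0 < newton ->
  [/\ 0 < delta, delta <= newton &
      delta = newton \/
      exists2 s, s \in LI_active I d & s \notin LI_active I (d + delta)].
Proof.
move=> hd n0; have /LI_start_leP[d0 _] := hd.
have mineD x y : deactivating d x -> deactivating d y -> deactivating d (mine x y).
  by move=> hx hy; rewrite /mine; case: ifP.
rewrite /delta /LI_increment -/(gap _ F) -/(slope d F) -/newton.
set b := (X in mine _ X).
have : deactivating d b.
  apply: (mineD _ _); elim/big_ind: _ => [|x y|s];
    try exact: (mineD x y); try by left.
    rewrite inE => /andP[sF sA]; apply: (deactivating_cap sA).
    by rewrite /cap sF.
  rewrite inE => /andP[sF sA]; apply: (deactivating_cap sA).
  (* Outside the input solution the algorithm measures the distance from
     [d / w], and not from [- d / w], to the lower bound. *)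
  rewrite /cap (negbTE sF) addeC leeD2r // -EFinN lee_fin.
  have : 0 <= d / w s by rewrite divr_ge0 // ltW // weight_gt0.
  lra.
case=> [->|[r [-> r0 rA]]]; first by rewrite miney; split=> //; left.
rewrite -EFin_min /= minEle; have [_|rn] := leP newton r; first by split=> //; left.
by split=> //; [exact: ltW|right].
Qed.

(** * Counting the iterations *)

(** A copy of [inv_weight] in [nat], on which the measure can be built. *)
Definition inv_weight_nat (X : {set S}) : nat :=
  \sum_(s in X) Num.truncn (w s)^-1.

Lemma inv_weight_natE X : (inv_weight_nat X)%:R = inv_weight I X.
Proof.
rewrite /inv_weight_nat natr_sum; apply: eq_bigr => s _; apply: truncnK.
by rewrite natrEint weight_inv_int invr_ge0 ltW // weight_gt0.
Qed.

Lemma inv_weight_nat_le X : (inv_weight_nat X <= inv_weight_nat [set: S])%N.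
Proof.
rewrite /inv_weight_nat big_mkcond [leqRHS]big_mkcond leq_sum // => s _.
by rewrite inE; case: ifP.
Qed.

Lemma card_le_inv_weight : (#|S| <= inv_weight_nat [set: S])%N.
Proof.
rewrite -(ler_nat R) inv_weight_natE /inv_weight -sum1_card natr_sum.
rewrite big_mkcond [leRHS]big_mkcond; apply: ler_sum => s _.
by rewrite !inE; exact: weight_inv_ge1.
Qed.

(** A lexicographic measure in mixed radix: first the number of active
    elements, then the slope, which is less than the radix. A member that is not
    cheaper than the input solution ends the search, hence the value 0. *)
Definition potential d F : nat :=
  if 0 < gap (dev I d) F then
    #|LI_active I d| * (inv_weight_nat [set: S]).+1
    + inv_weight_nat (symdiff (Fstar I) F :&: LI_active I d)
  else 0.

Lemma potential_le d F :
  (potential d F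
    <= #|S| * (inv_weight_nat [set: S]).+1 + inv_weight_nat [set: S])%N.
Proof.
rewrite /potential; case: ifP => // _.
by rewrite leq_add ?inv_weight_nat_le // leq_mul2r max_card orbT.
Qed.

(** A step that deactivates no element is a full Newton step on an affine
    piece. The new member [G] beats [F] at the end of the step, where the gap
    of [F] vanishes, but not at its beginning, so its slope is smaller. If an
    element is deactivated, the first component of the measure decreases. *)
Lemma potential_decreases d F G (d' := d + LI_increment I d F) :
  LI_start I <= d ->
  (forall H, H \in feas I -> gap (dev I d) H <= gap (dev I d) F) ->
  G \in feas I -> 0 < gap (dev I d) F ->
  symdiff (Fstar I) F :&: LI_active I d != set0 ->
  (potential d' G < potential d F)%N.
Proof.
move=> hd Fmax GI gF sF; have s0 := slope_gt0 sF.
have n0 : 0 < gap (dev I d) F / slope d F by exact: divr_gt0.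
have [i0 _ istep] := LI_incrementP hd n0.
have dd' : d <= d' by rewrite lerDl ltW.
have subA := active_nonincreasing dd'.
rewrite /potential gF; case: ifP => gG; last first.
  by rewrite addn_gt0 -!(ltr_nat R) inv_weight_natE -/(slope d F) s0 orbT.
have [eA|nA] := eqVneq (LI_active I d') (LI_active I d); last first.
  have ltA : (#|LI_active I d'| < #|LI_active I d|)%N.
    by apply: proper_card; rewrite properEneq nA.
  apply: leq_trans (leq_addr _ _).
  apply: (@leq_trans (#|LI_active I d'|.+1 * (inv_weight_nat [set: S]).+1)).
    by rewrite mulSn [leqRHS]addnC ltn_add2l ltnS inv_weight_nat_le.
  by rewrite leq_mul2r ltA orbT.
rewrite eA ltn_add2l -(ltr_nat R) !inv_weight_natE -/(slope d F) -/(slope d G).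
have iE : d' - d = gap (dev I d) F / slope d F.
  rewrite /d' addrC addKr; case: istep => // -[s sA].
  by rewrite -/d' eA sA.
have lF := gap_linear F hd dd' eA; have lG := gap_linear G hd dd' eA.
have gF' : (d' - d) * slope d F = gap (dev I d) F.
  by rewrite iE divfK // gt_eqF.
have dG := Fmax G GI.
have d'd : 0 < d' - d by rewrite iE.
by rewrite -(ltr_pM2l d'd); lra.
Qed.

(** * The run of the algorithm *)

Definition correct_outcome (out : outcome R S) : Prop :=
  match out with
  | Solution p => optimal_deviation I p
  | Infeasible => forall q, ~ feasible_deviation I q
  end.

Section Oracle.
Variable O : {ffun S -> R} -> {set S}.
Hypothesis oracleO : is_oracle I O.

Lemma oracle_gap_max d H : H \in feas I ->
  gap (dev I d) H <= gap (dev I d) (O (cost_at I d)).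
Proof.
by move=> HI; rewrite /gap lerD2l lerN2; apply: (oracleO (cost_at I d)).2.
Qed.

(** The second hypothesis is the invariant of the loop: [d] has not overshot
    the least feasible value. It makes a feasible [dev I d] optimal, and
    it survives a step because the gap of [F] is positive before the end of
    the Newton step. *)
Lemma LI_run_correct d k (F := O (cost_at I d)) :
  LI_start I <= d ->
  (forall e, LI_start I <= e -> e < d -> ~ feasible_deviation I (dev I e)) ->
  exists m out calls,
    [/\ iter m (LI_step I O) (Running d F k) = Halted out calls,
        correct_outcome out & (calls <= k + potential d F)%N].
Proof.
rewrite {}/F; have [n] := ubnP (potential d (O (cost_at I d))).
elim: n => // n IHn in d k *; set F := O _ => potn hd below.
have FI : F \in feas I by exact: (oracleO (cost_at I d)).1.
have [gF|gF] := ltP 0 (gap (dev I d) F); last first.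
  exists 1, (Solution (dev I d)), k; split; last exact: leq_addr.
    by rewrite /= /cost_at -subr_gt0 -/(gap _ F) ltNge gF.
  split=> [|q qfeas].
    apply/feasible_deviationP; split=> [H HI|]; last exact: dev_itv.
    exact: le_trans (oracle_gap_max d HI) gF.
  have /feasible_deviationP[_ qI] := qfeas.
  apply: le_trans (wnorm_dev hd) _; rewrite leNgt; apply/negP => qd.
  apply: below qd _; first exact: LI_start_le_wnorm.
  exact: feasible_dev_wnorm.
have infeas e : 0 < gap (dev I e) F -> ~ feasible_deviation I (dev I e).
  by move=> ge /feasible_deviationP[/(_ F FI)]; rewrite leNgt ge.
have [sF|sF] := eqVneq (symdiff (Fstar I) F :&: LI_active I d) set0.
  exists 1, Infeasible, k; split; last exact: leq_addr.
    by rewrite /= /cost_at -subr_gt0 -/(gap _ F) gF -/F sF eqxx.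
  move=> q qfeas; have /feasible_deviationP[_ qI] := qfeas.
  have q0 := LI_start_le_wnorm qI; have := feasible_dev_wnorm qfeas.
  have [qd|dq] := ltP (wnorm_infty I q) d; first exact: below.
  (* With slope 0 the gap of [F] never decreases again. *)
  apply: infeas; apply: lt_le_trans gF _.
  have := gap_tangent F hd dq; rewrite /slope sF /inv_weight big_set0 mulr0.
  by rewrite subr_le0.
have s0 := slope_gt0 sF.
have n0 : 0 < gap (dev I d) F / slope d F by exact: divr_gt0.
have [i0 inewton _] := LI_incrementP hd n0.
set d' := d + LI_increment I d F.
have dd' : d <= d' by rewrite lerDl ltW.
have pot' := potential_decreases hd (oracle_gap_max d)
  (oracleO (cost_at I d')).1 gF sF.
have [|||m [out [calls [run ok bound]]]] := IHn d' k.+1.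
- exact: leq_trans pot' _.
- exact: le_trans hd dd'.
- move=> e he ed'; have [ed|de] := ltP e d; first exact: below.
  apply: infeas.
  have := gap_tangent F hd de.
  have : (e - d) * slope d F < gap (dev I d) F.
    rewrite -ltr_pdivlMr //; apply: lt_le_trans inewton.
    by rewrite ltrBlDl.
  lra.
exists m.+1, out, calls; split=> //.
  by rewrite iterSr /= /cost_at -subr_gt0 -/(gap _ F) gF -/F (negbTE sF).
by apply: leq_trans bound _; rewrite addSnnS leq_add2l.
Qed.

End Oracle.

End Inverse.

Theorem theorem12 (R : realType) :
  exists C : nat,
    forall (S : finType) (I : instance R S) (O : {ffun S -> R} -> {set S}),
      is_oracle I O ->
      exists (out : outcome R S) (calls : nat),
        [/\ LI_returns I O out calls,
            (exists p, optimal_deviation I p) ->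
              exists2 p, out = Solution p & optimal_deviation I p,
            ~ (exists p, optimal_deviation I p) -> out = Infeasible
          & (0 < #|S|)%N ->
              calls%:R <= C%:R * (#|S|%:R * inv_weight I [set: S])].
Proof.
exists 4%N => S I O oracleO.
have none e : LI_start I <= e -> e < LI_start I ->
    ~ feasible_deviation I (dev I e).
  by move=> he /(le_lt_trans he); rewrite ltxx.
have [m [out [calls [run ok bound]]]] :=
  LI_run_correct oracleO 1 (lexx (LI_start I)) none.
exists out, calls; split; first by exists m.
- by case: out ok {run} => [p|] ok [q qopt]; [exists p|case: (ok q qopt.1)].
- by case: out ok {run} => [p|] // ok []; exists p.
move=> S0; rewrite -inv_weight_natE -!natrM ler_nat.
apply: leq_trans bound _.
apply: leq_trans (leq_add (leqnn _) (potential_le _ _ _)) _.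
have := card_le_inv_weight I.
move: S0; move: #|S| (inv_weight_nat I _) => n W n0 nW.
by nia.
Qed.
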